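(* Consider the linear model $\mathbf{y}=\alpha\mathbf{1}_n+\mathbf{X}\boldsymbol{\beta}+\sigma\boldsymbol{\epsilon}$, where the error vector $\boldsymbol{\epsilon}$ has a spherically symmetric density $f(\boldsymbol{\epsilon}'\boldsymbol{\epsilon})$ on $\mathbb{R}^n$ with $E[\boldsymbol{\epsilon}]=\mathbf{0}_n$ and $\mathrm{Var}[\boldsymbol{\epsilon}]=\mathbf{I}_n$. Let $\pi(\alpha,\boldsymbol{\beta})$ be a nonnegative (possibly improper) prior density on $(\alpha,\boldsymbol{\beta})\in\mathbb{R}\times\mathbb{R}^p$ and consider the joint (generalized) prior $\pi(\alpha,\boldsymbol{\beta},\sigma^2)=\pi(\alpha,\boldsymbol{\beta})\{\sigma^2\}^{-1}$. Then the generalized Bayes estimator of $\sigma^2$ with respect to this prior under Stein's loss $L_S(\delta,\sigma^2)=\delta/\sigma^2-\log(\delta/\sigma^2)-1$ does not depend on the particular spherically symmetric density $f$; in particular it coincides with the generalized Bayes estimator obtained when $\boldsymbol{\epsilon}\sim N_n(\mathbf{0}_n,\mathbf{I}_n)$.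
   Context: Here $\mathbf{y}\in\mathbb{R}^n$ is observed, $\alpha\in\mathbb{R}$ is an unknown intercept, $\mathbf{1}_n$ is the $n$-vector of ones, $\mathbf{X}=(\mathbf{x}_1,\dots,\mathbf{x}_p)$ is a known $n\times p$ design matrix whose columns are centered ($\mathbf{x}_i'\mathbf{1}_n=0$) and linearly independent (rank $p$), $n>p+1$, $\boldsymbol{\beta}\in\mathbb{R}^p$ is unknown, and $\sigma>0$ is unknown. The generalized Bayes estimator under Stein's loss is the estimator minimizing the (generalized) posterior expected loss, namely $\{E[1/\sigma^2\mid\mathbf{y}]\}^{-1}$, where the posterior is formed from the likelihood $\sigma^{-n}f(\|\mathbf{y}-\alpha\mathbf{1}_n-\mathbf{X}\boldsymbol{\beta}\|^2/\sigma^2)$ and the given prior (assumed to yield finite posterior quantities). *)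

(* Defs.v *)
From HB Require Import structures.
From mathcomp Require Import all_boot all_order all_algebra.
From mathcomp Require Import all_classical all_reals all_analysis.
Set Implicit Arguments. Unset Strict Implicit. Unset Printing Implicit Defensive.
Import Order.TTheory GRing.Theory Num.Theory.
Import numFieldNormedType.Exports.
Local Open Scope classical_set_scope.
Local Open Scope ring_scope.

Section Defs.
Variable R : realType.

Fixpoint lebint_tuple (n : nat) : (n.-tuple R -> \bar R) -> \bar R :=
  match n with
  | 0 => fun F => F [tuple]
  | m.+1 => fun F =>
      (\int[@lebesgue_measure R]_x lebint_tuple (fun t => F [tuple of x :: t]))%E
  end.

Definition tcol (n : nat) (t : n.-tuple R) : 'cV[R]_n := \col_i tnth t i.

Definition lebint_cV (n : nat) (F : 'cV[R]_n -> \bar R) : \bar R :=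
  lebint_tuple (fun t => F (tcol t)).

Definition sqn (n : nat) (v : 'cV[R]_n) : R := (v^T *m v) 0 0.

Definition ones (n : nat) : 'cV[R]_n := const_mx 1.

Definition spherical_density (n : nat) (f : R -> R) : Prop :=
  [/\ measurable_fun (`[0%R, +oo[%classic : set R) f,
      (forall t, 0 <= t -> 0 <= f t),
      lebint_cV (fun e : 'cV[R]_n => (f (sqn e))%:E) = 1%E,
      (forall i : 'I_n,
          (lebint_cV (fun e : 'cV[R]_n => (`|e i 0| * f (sqn e))%:E) < +oo)%E /\
          lebint_cV (fun e : 'cV[R]_n => (e i 0 * f (sqn e))%:E) = 0%E)
    & (forall i j : 'I_n,
          (lebint_cV (fun e : 'cV[R]_n => (`|e i 0 * e j 0| * f (sqn e))%:E) < +oo)%E /\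
          lebint_cV (fun e : 'cV[R]_n => (e i 0 * e j 0 * f (sqn e))%:E)
            = ((i == j)%:R)%:E)].

Definition gauss_gen (n : nat) (t : R) : R :=
  (Num.sqrt (2 * pi)) ^- n * expR (- (t / 2)).

(* generalized posterior integral of s^{-k} (s = sigma^2) for the model
   y = alpha 1_n + X beta + sigma eps, likelihood sigma^{-n} f(||y - alpha 1 - X beta||^2/sigma^2),
   prior pi(alpha,beta) (sigma^2)^{-1}; integration over
   (alpha, beta, sigma^2) in R x R^p x (0, +oo) *)
Definition post_int (n p : nat) (f : R -> R) (prior : R -> 'cV[R]_p -> R)
    (X : 'M[R]_(n, p)) (y : 'cV[R]_n) (k : nat) : \bar R :=
  (\int[@lebesgue_measure R]_a lebint_cV (fun b : 'cV[R]_p =>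
     \int[@lebesgue_measure R]_(s in (`]0%R, +oo[%classic : set R))
       ((s ^- k) * ((Num.sqrt s) ^- n * f (sqn (y - a *: ones n - X *m b) / s))
         * (prior a b * s^-1))%:E))%E.

(* generalized Bayes estimator of sigma^2 under Stein's loss:
   { E[1/sigma^2 | y] }^{-1} *)
Definition gb_stein (n p : nat) (f : R -> R) (prior : R -> 'cV[R]_p -> R)
    (X : 'M[R]_(n, p)) (y : 'cV[R]_n) : R :=
  (fine (post_int f prior X y 1) / fine (post_int f prior X y 0))^-1.

End Defs.

(* Main.v *)
(* Substituting s = q s', the sigma^2-integral of the integrand of order k
   equals pi(alpha, beta) q^(-k - n/2) c_k(f), where q is the residual sum of
   squares and c_k(f) is the same integral with q = 1 and no prior; so only c_0
   and c_1 must be shown to be independent of f. Polar coordinates are avoided: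
   evaluating by Tonelli, in both orders,
     int_(R^n) int_(s > 0) s^(-k-1-n/2) f(|e|^2 / s) |e|^(2k+2) 1_[1,2](|e|^2),
   and using dilations e = sqrt s e', gives
   A c_k(f) = int_(R^n) |e|^(2k) f(|e|^2) with a constant A independent of f and
   k. For a density with identity covariance the right-hand side is 1 for k = 0
   and n for k = 1. *)
Require Import Defs.
From HB Require Import structures.
From mathcomp Require Import all_boot all_order all_algebra.
From mathcomp Require Import all_classical all_reals all_analysis.
From mathcomp Require Import measurable_realfun normal_distribution ring.
Import Order.TTheory GRing.Theory Num.Theory.
Import numFieldNormedType.Exports.
Local Open Scope classical_set_scope.
Local Open Scope ring_scope.
Set Implicit Arguments.
Unset Strict Implicit.
Unset Printing Implicit Defensive.

(** * Iterated Lebesgue integrals over R^n: Tonelli, linearity and dilations *)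

Section iterated_integral.
Context {R : realType}.
Local Open Scope ereal_scope.
Local Notation leb := (@lebesgue_measure R).

Lemma lebint_tuple_ge0 (n : nat) (F : n.-tuple R -> \bar R) :
  (forall t, 0 <= F t) -> 0 <= lebint_tuple F.
Proof.
elim: n F => [|n IH] F F0 /=; first exact: F0.
by apply: integral_ge0 => x _; apply: IH.
Qed.

Lemma eq_lebint_tuple (n : nat) (F G : n.-tuple R -> \bar R) :
  F =1 G -> lebint_tuple F = lebint_tuple G.
Proof. by move=> /funext ->. Qed.

(** Reassociates T * R^(n+1) as (T * R) * R^n, so that an induction on the dimension can absorb the
    first coordinate into the parameter space. *)
Lemma measurable_cons_pair d (T : measurableType d) (n : nat)
    (F : T * n.+1.-tuple R -> \bar R) :
  measurable_fun [set: T * n.+1.-tuple R] F ->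
  measurable_fun [set: (T * R) * n.-tuple R]
    (fun z : (T * R) * n.-tuple R => F (z.1.1, [tuple of z.1.2 :: z.2])).
Proof.
move=> mF.
apply: (measurableT_comp mF).
apply: measurable_fun_pair; first exact: measurableT_comp.
by apply: measurable_cons => //; exact: measurableT_comp.
Qed.

(** Induction on [n] with the parameter space [T] left general, since it grows by one real
    coordinate at each step; that coordinate is then integrated out by the measurability part of
    Tonelli's theorem. *)
Lemma measurable_lebint_tuple (n : nat) d (T : measurableType d)
    (F : T * n.-tuple R -> \bar R) :
  measurable_fun [set: T * n.-tuple R] F -> (forall z, 0 <= F z) ->
  measurable_fun setT (fun x => lebint_tuple (fun t => F (x, t))).
Proof.
elim: n d T F => [|n IH] d T F mF F0 /=; first exact: measurable_fun_pair1.
pose G (z : T * R) := lebint_tuple (fun t => F (z.1, [tuple of z.2 :: t])).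
apply: (@measurable_fun_fubini_tonelli_F _ _ _ _ _ leb G).
  exact: (IH _ _ _ (measurable_cons_pair mF) (fun z => F0 _)).
by move=> z; exact: lebint_tuple_ge0.
Qed.

(** The integral over [mu] moves past one coordinate at a time by the two-variable Tonelli
    theorem. *)
Lemma lebint_tuple_tonelli (n : nat) d (T : measurableType d)
    (mu : {sigma_finite_measure set T -> \bar R})
    (F : T * n.-tuple R -> \bar R) :
  measurable_fun [set: T * n.-tuple R] F -> (forall z, 0 <= F z) ->
  \int[mu]_x lebint_tuple (fun t => F (x, t)) =
  lebint_tuple (fun t => \int[mu]_x F (x, t)).
Proof.
elim: n F => [|n IH] F mF F0 //=.
pose G (z : T * R) := lebint_tuple (fun t => F (z.1, [tuple of z.2 :: t])).
rewrite (@fubini_tonelli _ _ _ _ _ mu leb G); last 2 first.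
- exact: (measurable_lebint_tuple (measurable_cons_pair mF) (fun z => F0 _)).
- by move=> z; exact: lebint_tuple_ge0.
apply: eq_integral => y _.
rewrite -(IH (fun z => F (z.1, [tuple of y :: z.2])))//.
apply: (measurableT_comp mF).
by apply: measurable_fun_pair => //; exact: measurable_cons.
Qed.

Lemma measurable_lebint_cons (n : nat) (F : n.+1.-tuple R -> \bar R) :
  measurable_fun [set: n.+1.-tuple R] F ->
  measurable_fun [set: R * n.-tuple R]
    (fun z : R * n.-tuple R => F [tuple of z.1 :: z.2]).
Proof.
by move=> mF; apply: measurableT_comp => //; exact: measurable_cons.
Qed.

Lemma lebint_tupleZl (n : nat) (k : \bar R) (F : n.-tuple R -> \bar R) :
  measurable_fun [set: n.-tuple R] F -> (forall t, 0 <= F t) -> 0 <= k ->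
  lebint_tuple (fun t => k * F t) = k * lebint_tuple F.
Proof.
elim: n F => [|n IH] F mF F0 k0 //=.
have mFc := measurable_lebint_cons mF.
rewrite -ge0_integralZl//; last 2 first.
- exact: (measurable_lebint_tuple mFc (fun z => F0 _)).
- by move=> x _; exact: lebint_tuple_ge0.
apply: eq_integral => x _; apply: IH => //.
exact: (measurable_fun_pair2 _ mFc).
Qed.

Lemma lebint_tupleD (n : nat) (F G : n.-tuple R -> \bar R) :
  measurable_fun [set: n.-tuple R] F -> measurable_fun [set: n.-tuple R] G ->
  (forall t, 0 <= F t) -> (forall t, 0 <= G t) ->
  lebint_tuple (fun t => F t + G t) = lebint_tuple F + lebint_tuple G.
Proof.
elim: n F G => [|n IH] F G mF mG F0 G0 //=.
have mFc := measurable_lebint_cons mF.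
have mGc := measurable_lebint_cons mG.
rewrite -ge0_integralD//; last 4 first.
- by move=> x _; exact: lebint_tuple_ge0.
- exact: (measurable_lebint_tuple mFc (fun z => F0 _)).
- by move=> x _; exact: lebint_tuple_ge0.
- exact: (measurable_lebint_tuple mGc (fun z => G0 _)).
apply: eq_integral => x _; apply: IH => //.
- exact: (measurable_fun_pair2 _ mFc).
- exact: (measurable_fun_pair2 _ mGc).
Qed.

Lemma lebint_tuple_sum (n m : nat) (F : 'I_m -> n.-tuple R -> \bar R) :
  (forall i, measurable_fun [set: n.-tuple R] (F i)) ->
  (forall i t, 0 <= F i t) ->
  lebint_tuple (fun t => \sum_i F i t) = \sum_i lebint_tuple (F i).
Proof.
elim: m F => [|m IH] F mF F0.
  rewrite big_ord0; under eq_lebint_tuple do rewrite big_ord0.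
  by elim: n {F mF F0} => //= n IH; under eq_integral do rewrite IH;
     rewrite integral0.
rewrite big_ord_recl -IH//.
rewrite -lebint_tupleD//; last 2 first.
- exact: emeasurable_sum.
- by move=> t; exact: sume_ge0.
by apply: eq_lebint_tuple => t; rewrite big_ord_recl.
Qed.

(** A single point is Lebesgue-null. This serves to discard one exceptional value of the first
    coordinate of e, and later one exceptional value of the intercept. *)
Lemma ge0_eq_integral_off_point (F G : R -> \bar R) (a : R) :
  measurable_fun setT F -> measurable_fun setT G ->
  (forall x, 0 <= F x) -> (forall x, 0 <= G x) ->
  (forall x, x != a -> F x = G x) ->
  \int[leb]_x F x = \int[leb]_x G x.
Proof.
move=> mF mG F0 G0 FG; apply: ge0_ae_eq_integral => //.
exists [set a]; split => //; first exact: lebesgue_measure_set1.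
move=> x /= /not_implyP[_ xFG]; apply: contrapT => xa.
by apply: xFG; apply: FG; apply/eqP.
Qed.

(** Lebesgue measure is determined by its values on the intervals ]a, b], and [c] times its
    pushforward under multiplication by [c] gives each of them its length. *)
Lemma ge0_integral_scale (c : R) (F : R -> \bar R) :
  (0 < c)%R -> measurable_fun setT F -> (forall x, 0 <= F x) ->
  \int[leb]_x F x = c%:E * \int[leb]_x F (c * x)%R.
Proof.
move=> c0 mF F0.
pose phi : R -> measurableTypeR R := fun x => (c * x)%R.
have mphi : measurable_fun setT phi by exact: mulrl_measurable.
pose nu : {measure set (measurableTypeR R) -> \bar R} :=
  mscale (NngNum (ltW c0))
   (measure_function_pushforward__canonical__measure_function_Measure leb mphi).
have lebE A : measurable A -> leb A = nu A.
  apply: lebesgue_measure_unique => _ [[a b]] _ <- /=.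
  have -> : nu `]a, b]%classic = c%:E * leb `](a / c)%R, (b / c)%R]%classic.
    rewrite /nu /= /mscale /=; congr (_ * leb _).
    apply/seteqP; split => x /=; rewrite !in_itv /= /phi;
      by rewrite ltr_pdivrMr// ler_pdivlMr// mulrC.
  rewrite !lebesgue_measure_itv /= !lte_fin ltr_pM2r ?invr_gt0//.
  case: ifP => _; last by rewrite mule0.
  by rewrite -!EFinB -EFinM -mulrBl mulrCA divff ?mulr1// gt_eqF.
rewrite (eq_measure_integral nu)//=; last by move=> A mA _; exact: lebE.
rewrite ge0_integral_mscale//=.
by congr (_ * _); rewrite ge0_integral_pushforward.
Qed.

Lemma measurable_map_scale (c : R) (n : nat) :
  measurable_fun [set: n.-tuple R] (map_tuple ( *%R c) : _ -> n.-tuple R).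
Proof.
apply/measurable_fun_tnthP => i.
rewrite (_ : _ \o _ = fun t : n.-tuple R => (c * tnth t i)%R); last first.
  by apply/funext => t /=; rewrite tnth_map.
by apply: measurable_funM => //; exact: measurable_tnth.
Qed.

(** Each coordinate contributes one factor [c] through the one-dimensional dilation. *)
Lemma lebint_tuple_scale (c : R) (n : nat) (F : n.-tuple R -> \bar R) :
  (0 < c)%R -> measurable_fun [set: n.-tuple R] F -> (forall t, 0 <= F t) ->
  lebint_tuple F =
  (c ^+ n)%:E * lebint_tuple (fun t => F (map_tuple ( *%R c) t)).
Proof.
move=> c0; elim: n F => [|n IH] F mF F0 /=.
  by rewrite mul1e; congr F; exact: val_inj.
have mFc := measurable_lebint_cons mF.
have mmap := measurable_map_scale c.
rewrite (ge0_integral_scale c0)//; last 2 first.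
- exact: (measurable_lebint_tuple mFc (fun z => F0 _)).
- by move=> x; exact: lebint_tuple_ge0.
rewrite exprS EFinM -muleA; congr (_ * _).
have mG : measurable_fun [set: R * n.-tuple R]
    (fun z => F (map_tuple ( *%R c) [tuple of z.1 :: z.2])).
  apply: (measurable_lebint_cons (F := fun t => F (map_tuple ( *%R c) t))).
  exact: (measurableT_comp mF (mmap n.+1)).
rewrite -ge0_integralZl//; last 3 first.
- by apply: (measurable_lebint_tuple mG) => z; exact: F0.
- by move=> x _; exact: lebint_tuple_ge0.
- by rewrite lee_fin exprn_ge0// ltW.
apply: eq_integral => x _; rewrite IH//; last exact: (measurable_fun_pair2 _ mFc).
congr (_ * _); apply: eq_lebint_tuple => t; congr F; exact: val_inj.
Qed.

End iterated_integral.

(** * Radial integration and the constants c_k *)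

Section radial.
Context {R : realType}.
Local Notation leb := (@lebesgue_measure R).

(** Inversion is discontinuous at 0, so it is written as x (x^2)^(-1) with a measurable power
    function; at x = 0 both sides are 0. *)
Lemma measurable_invr : measurable_fun [set: R] (@GRing.inv R).
Proof.
rewrite (_ : @GRing.inv R = fun x => x * (x ^+ 2) `^ (- 1)); last first.
  apply/funext => x; rewrite powR_inv1 ?sqr_ge0// expr2 invfM mulrA.
  by have [->|x0] := eqVneq x 0; [rewrite invr0 !mulr0|rewrite divff// mul1r].
apply: measurable_funM; first exact: measurable_id.
have H := measurableT_comp (@measurable_powR R (- 1)) (@exprn_measurable R setT 2).
exact: H.
Qed.

Lemma measurable_sqrtr : measurable_fun [set: R] (@Num.sqrt R).
Proof. apply: continuous_measurable_fun; exact: sqrt_continuous. Qed.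

Lemma sqnE (n : nat) (v : 'cV[R]_n) : sqn v = \sum_i v i 0 ^+ 2.
Proof. by rewrite /sqn mxE; apply: eq_bigr => i _; rewrite mxE expr2. Qed.

Lemma sqn_ge0 (n : nat) (v : 'cV[R]_n) : 0 <= sqn v.
Proof. by rewrite sqnE; apply: sumr_ge0 => i _; exact: sqr_ge0. Qed.

Lemma sqn_eq0 (n : nat) (v : 'cV[R]_n) : sqn v = 0 -> v = 0.
Proof.
rewrite sqnE => /eqP; rewrite psumr_eq0; last by move=> i _; exact: sqr_ge0.
move=> /allP v0; apply/colP => i; rewrite mxE; apply/eqP.
by rewrite -sqrf_eq0; exact: v0 (mem_index_enum i).
Qed.

Lemma sqn_tcol_cons (n : nat) (x : R) (t : n.-tuple R) :
  sqn (tcol [tuple of x :: t]) = x ^+ 2 + sqn (tcol t).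
Proof.
rewrite !sqnE big_ord_recl mxE tnth0; congr (_ + _).
by apply: eq_bigr => i _; rewrite !mxE tnthS.
Qed.

Lemma sqn_tcol_scale (n : nat) (c : R) (t : n.-tuple R) :
  sqn (tcol (map_tuple ( *%R c) t)) = c ^+ 2 * sqn (tcol t).
Proof.
rewrite !sqnE mulr_sumr; apply: eq_bigr => i _.
by rewrite !mxE tnth_map exprMn.
Qed.

Lemma measurable_sqn_tcol (n : nat) :
  measurable_fun [set: n.-tuple R] (fun t => sqn (tcol t)).
Proof.
rewrite (_ : (fun t => _) = fun t : n.-tuple R => \sum_i tnth t i ^+ 2).
  by apply: measurable_sum => i; apply: measurable_funX; exact: measurable_tnth.
by apply/funext => t; rewrite sqnE; apply: eq_bigr => i _; rewrite mxE.
Qed.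

(** The sigma^2-integral for residual sum of squares [q], with the factor pi(alpha, beta) left out;
    its value at [q = 1] is the constant c_k. *)
Definition scale_int (n k : nat) (g : R -> R) (q : R) : \bar R :=
  (\int[leb]_(s in (`]0%R, +oo[%classic : set R))
     (s ^- k * (Num.sqrt s ^- n * g (q / s)) * s^-1)%:E)%E.

(** Extends integrals over ]0, +oo[ to the whole line, where the dilation and Tonelli lemmas
    apply. *)
Definition positive_indic (s : R) : R := \1_(`]0, +oo[%classic) s.

Lemma positive_indicE (s : R) : positive_indic s = (0 < s)%R%:R.
Proof. by rewrite /positive_indic indicE mem_setE in_itv /= andbT. Qed.

Lemma integral_positive (F : R -> R) :
  (\int[leb]_(s in (`]0%R, +oo[%classic : set R)) (F s)%:E =
   \int[leb]_s (positive_indic s * F s)%:E)%E.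
Proof.
rewrite integral_mkcond; apply: eq_integral => s _.
by rewrite patchE /positive_indic indicE; case: (s \in _); rewrite ?mul1r ?mul0r.
Qed.

Lemma measurable_positive_indic : measurable_fun [set: R] positive_indic.
Proof. by apply: measurable_indic; exact: measurable_itv. Qed.

Lemma measurable_scale_integrand d (T : measurableType d) (n k : nat)
    (g : R -> R) (q s : T -> R) :
  measurable_fun setT g -> measurable_fun setT q -> measurable_fun setT s ->
  measurable_fun setT
    (fun z => s z ^- k * (Num.sqrt (s z) ^- n * g (q z / s z)) * (s z)^-1).
Proof.
move=> mg mq ms.
have mVs : measurable_fun setT (fun z => (s z)^-1).
  exact: (measurableT_comp measurable_invr).
apply: measurable_funM => //; apply: measurable_funM.
  apply: (measurableT_comp measurable_invr); exact: measurable_funX.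
apply: measurable_funM.
  apply: (measurableT_comp measurable_invr); apply: measurable_funX.
  exact: (measurableT_comp measurable_sqrtr).
by apply: (measurableT_comp mg); exact: measurable_funM.
Qed.

Lemma scale_int_ge0 (n k : nat) (g : R -> R) (q : R) :
  (forall r, 0 <= g r) -> (0 <= scale_int n k g q)%E.
Proof.
move=> g0; apply: integral_ge0 => s /=; rewrite in_itv /= andbT => s0.
by rewrite lee_fin !mulr_ge0 ?invr_ge0 ?exprn_ge0 ?sqrtr_ge0// ltW.
Qed.

Lemma measurable_positive_scale_integrand (n k : nat) (g : R -> R) (q : R) :
  measurable_fun setT g ->
  measurable_fun [set: R] (fun s => (positive_indic s *
    (s ^- k * (Num.sqrt s ^- n * g (q / s)) * s^-1))%:E).
Proof.
move=> mg; apply/measurable_EFinP; apply: measurable_funM.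
  exact: measurable_positive_indic.
exact: measurable_scale_integrand.
Qed.

Lemma positive_scale_integrand_ge0 (n k : nat) (g : R -> R) (q s : R) :
  (forall r, 0 <= g r) ->
  (0 <= (positive_indic s *
    (s ^- k * (Num.sqrt s ^- n * g (q / s)) * s^-1))%:E)%E.
Proof.
move=> g0; rewrite lee_fin positive_indicE; have [s0|] := ltP 0 s;
  last by rewrite mul0r.
by rewrite !mulr_ge0 ?invr_ge0 ?exprn_ge0 ?sqrtr_ge0// ltW.
Qed.

(** Under s = q s' the argument of [g] becomes 1/s', the measure ds/s is invariant, and the
    remaining powers of s release q^(-k) and q^(-n/2). *)
Lemma scale_intE (n k : nat) (g : R -> R) (q : R) :
  measurable_fun setT g -> (forall r, 0 <= g r) -> 0 < q ->
  scale_int n k g q = ((q ^- k * Num.sqrt q ^- n)%:E * scale_int n k g 1)%E.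
Proof.
move=> mg g0 q0; have nz : q != 0 by rewrite gt_eqF.
have mF := @measurable_positive_scale_integrand n k g _ mg.
have F0 q' s := @positive_scale_integrand_ge0 n k g q' s g0.
rewrite /scale_int !integral_positive (ge0_integral_scale q0)//.
rewrite -ge0_integralZl//; last 2 first.
- by have H := measurableT_comp (mF q) (@mulrl_measurable R setT q); exact: H.
- by rewrite lee_fin ltW.
rewrite -ge0_integralZl//; last 2 first.
- exact: mF.
- by rewrite lee_fin mulr_ge0// invr_ge0 exprn_ge0 ?sqrtr_ge0// ltW.
apply: eq_integral => s _; rewrite -!EFinM !positive_indicE pmulr_rgt0//; congr EFin.
have [s0|] := ltP 0 s; last by rewrite !mul0r !mulr0.
have snz : s != 0 by rewrite gt_eqF.
have -> : q / (q * s) = 1 / s by field; rewrite nz snz.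
rewrite !mul1r exprMn sqrtrM ?ltW// exprMn !invfM.
move: (q ^- k) (s ^- k) (_ ^- n) (_ ^- n) (g _) => A B C D G.
by field; rewrite nz snz.
Qed.

(** A cut-off supported away from 0. As [1, 2] has length 1, integrating its dilate over s gives
    exactly 1/r. *)
Definition indic12 (r : R) : R := \1_(`[1, 2]%classic) r.

Lemma indic12E (r : R) : indic12 r = (1 <= r <= 2)%R%:R.
Proof. by rewrite /indic12 indicE mem_setE in_itv. Qed.

Lemma measurable_indic12 : measurable_fun [set: R] indic12.
Proof. by apply: measurable_indic; exact: measurable_itv. Qed.

Lemma indic12_ge0 r : 0 <= indic12 r. Proof. by rewrite indic12E ler0n. Qed.

(* The length of [1/r, 2/r] for r > 0; at r = 0 both sides are 0. *)
Lemma integral_indic12_scale (r : R) : 0 <= r ->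
  (\int[leb]_s (positive_indic s * indic12 (s * r))%:E = (r^-1)%:E)%E.
Proof.
rewrite le_eqVlt => /predU1P[<-|r0].
  rewrite invr0; apply: integral0_eq => s _.
  by rewrite mulr0 indic12E ler10 mulr0.
have nz : r != 0 by rewrite gt_eqF.
transitivity (\int[leb]_s (\1_(`[r^-1, 2 / r]%classic) s)%:E)%E.
  apply: eq_integral => s _; congr EFin.
  rewrite positive_indicE indic12E indicE mem_setE in_itv /= -natrM mulnb.
  congr (nat_of_bool _)%:R.
  rewrite ler_pdivlMr// -[r^-1]mul1r ler_pdivrMr// andb_idl// => /andP[h _].
  by rewrite -(pmulr_lgt0 _ r0) (lt_le_trans ltr01).
rewrite integral_indic ?setIT//= lebesgue_measure_itv /=.
rewrite lte_fin ltr_pdivlMr// mulVf// ltr1n -EFinB; congr EFin; field.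
exact: nz.
Qed.

(** At r = |e|^2 this is |e|^(2-n) on the shell 1 <= |e|^2 <= 2; its integral over R^n is the
    constant A. *)
Definition radial_weight (n : nat) (r : R) : R := r * Num.sqrt r ^- n * indic12 r.

(** Stands in for polar coordinates: the dimensional constant enters only through the integral of
    [radial_weight], to be cancelled when two densities are compared. *)
Lemma radial_identity (n k : nat) (g : R -> R) :
  (0 < n)%N -> measurable_fun setT g -> (forall r, 0 <= g r) ->
  (scale_int n k g 1 *
   lebint_tuple (fun t : n.-tuple R => (radial_weight n (sqn (tcol t)))%:E) =
   lebint_tuple (fun t : n.-tuple R =>
     (sqn (tcol t) ^+ k * g (sqn (tcol t)))%:E))%E.
Proof.
move=> n0 mg g0.
pose r (t : n.-tuple R) := sqn (tcol t).
have mr : measurable_fun [set: n.-tuple R] r by exact: measurable_sqn_tcol.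
have r0 t : 0 <= r t by exact: sqn_ge0.
have mindic12 (d : measure_display) (T : measurableType d) (u : T -> R) :
    measurable_fun setT u -> measurable_fun setT (fun z => indic12 (u z)).
  by move=> mu; exact: (measurableT_comp measurable_indic12).
(* The exponent [k.+1] serves both orders of integration. Integrating over s first produces r^(-k),
   which leaves a weight free of k; dilating e first produces s^(k+1), which cancels s^(-k-1). *)
pose H (z : R * n.-tuple R) : \bar R := (positive_indic z.1 *
  (z.1 ^- k * (Num.sqrt z.1 ^- n * g (r z.2 / z.1)) * z.1^-1 *
   (r z.2 ^+ k.+1 * indic12 (r z.2))))%:E.
have mr2 : measurable_fun [set: R * n.-tuple R] (fun z => r z.2).
  exact: (measurableT_comp mr).
have mH : measurable_fun [set: R * n.-tuple R] H.
  apply/measurable_EFinP; apply: measurable_funM.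
    exact: (measurableT_comp measurable_positive_indic).
  apply: measurable_funM; first exact: measurable_scale_integrand.
  by apply: measurable_funM; [exact: measurable_funX|exact: mindic12].
have H0 z : (0 <= H z)%E.
  rewrite lee_fin positive_indicE; have [s0|] := ltP 0 z.1; last by rewrite mul0r.
  by rewrite !mulr_ge0 ?invr_ge0 ?exprn_ge0 ?sqrtr_ge0// ltW.
have weight_ge0 q : 0 <= q -> 0 <= radial_weight n q.
  by move=> q0; rewrite !mulr_ge0 ?invr_ge0 ?exprn_ge0 ?sqrtr_ge0.
have mweight :
    measurable_fun [set: n.-tuple R] (fun t => (radial_weight n (r t))%:E).
  apply/measurable_EFinP; apply: measurable_funM; last exact: mindic12.
  apply: measurable_funM => //; apply: (measurableT_comp measurable_invr).
  by apply: measurable_funX; exact: (measurableT_comp measurable_sqrtr).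
rewrite -lebint_tupleZl//; last 2 first.
- by move=> t; rewrite lee_fin; exact: (weight_ge0 _ (r0 t)).
- exact: scale_int_ge0.
transitivity (lebint_tuple (fun t => \int[leb]_s H (s, t))%E).
  apply: eq_lebint_tuple => t; rewrite /H /= -/(r t).
  (* [scale_intE] requires a positive argument; at e = 0 the cut-off makes both sides vanish. *)
  have [rt0|rt0] := leP (r t) 0.
    have Ir : indic12 (r t) = 0 by rewrite indic12E leNgt (le_lt_trans rt0).
    rewrite /radial_weight Ir mulr0 mule0 integral0_eq// => s _.
    by rewrite !mulr0.
  transitivity ((r t ^+ k.+1 * indic12 (r t))%:E * scale_int n k g (r t))%E.
    rewrite (@scale_intE n k g (r t))// muleA -EFinM muleC; congr (_%:E * _)%E.
    rewrite /radial_weight exprS; have : r t ^+ k != 0 by rewrite expf_neq0// gt_eqF.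
    move: (r t ^+ k) (Num.sqrt (r t) ^- n) => A B A0.
    by field; rewrite A0.
  rewrite /scale_int integral_positive -ge0_integralZl//; last 3 first.
  - exact: measurable_positive_scale_integrand.
  - by move=> s _; exact: positive_scale_integrand_ge0.
  - by rewrite lee_fin mulr_ge0// exprn_ge0.
  by apply: eq_integral => s _; rewrite -EFinM; congr EFin; rewrite mulrC !mulrA.
rewrite -lebint_tuple_tonelli//.
(* The integrand after e = sqrt s e': [s] survives only in the cut-off. *)
pose G (z : R * n.-tuple R) : \bar R :=
  (g (r z.2) * r z.2 ^+ k.+1 * (positive_indic z.1 * indic12 (z.1 * r z.2)))%:E.
have mG : measurable_fun [set: R * n.-tuple R] G.
  apply/measurable_EFinP; apply: measurable_funM.
    apply: measurable_funM; last exact: measurable_funX.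
    exact: (measurableT_comp mg).
  apply: measurable_funM.
    exact: (measurableT_comp measurable_positive_indic).
  by apply: mindic12; exact: measurable_funM.
have G0 z : (0 <= G z)%E.
  by rewrite lee_fin !mulr_ge0 ?exprn_ge0// positive_indicE.
transitivity (\int[leb]_s lebint_tuple (fun t => G (s, t)))%E.
  apply: eq_integral => s _.
  have [s0|s0] := ltP 0 s; last first.
    by apply: eq_lebint_tuple => t; rewrite /H /G positive_indicE ltNge s0 !mul0r mulr0.
  have ss0 : 0 < Num.sqrt s by rewrite sqrtr_gt0.
  have mHs := measurable_fun_pair2 s mH.
  have mHss := measurableT_comp mHs (@measurable_map_scale _ (Num.sqrt s) n).
  (* The Jacobian (sqrt s)^n cancels the likelihood factor (sqrt s)^(-n). *)
  rewrite (lebint_tuple_scale ss0)// -lebint_tupleZl//.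
  apply: eq_lebint_tuple => t; rewrite /H /G -EFinM; congr EFin => /=.
  rewrite positive_indicE s0 !mul1r /r sqn_tcol_scale sqr_sqrtr ?ltW// -/(r t).
  have snz : s != 0 by rewrite gt_eqF.
  rewrite [s * r t]mulrC mulfK// exprMn [s ^+ k.+1]exprS.
  have : s ^+ k != 0 by rewrite expf_neq0.
  have : Num.sqrt s ^+ n != 0 by rewrite expf_neq0// gt_eqF.
  move: (s ^+ k) (Num.sqrt s ^+ n) (g _) (r t ^+ _) (indic12 _) => A B C D E B0 A0.
  by field; rewrite A0 B0 snz.
rewrite lebint_tuple_tonelli//.
(* The s-integral of the cut-off is 1/r, by [integral_indic12_scale]. *)
transitivity (lebint_tuple (fun t => (r t ^+ k.+1 / r t * g (r t))%:E)).
  apply: eq_lebint_tuple => t.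
  rewrite /G /=; under eq_integral do rewrite EFinM.
  rewrite ge0_integralZl//; last 3 first.
  - apply/measurable_EFinP; apply: measurable_funM.
      exact: measurable_positive_indic.
    by apply: mindic12; exact: mulrr_measurable.
  - by move=> s _; rewrite lee_fin mulr_ge0// positive_indicE.
  - by rewrite lee_fin mulr_ge0// exprn_ge0.
  rewrite integral_indic12_scale// -EFinM; congr EFin.
  by rewrite [RHS]mulrC mulrA.
(* The integrands differ only at e = 0, and only for k = 0 (r / r = 0 at r = 0). *)
case: n n0 @r mr r0 {H mH H0 mr2 weight_ge0 mweight G mG G0} => // n _ r mr r0 /=.
have mK (h : R -> R) : measurable_fun setT h ->
    measurable_fun [set: n.+1.-tuple R] (fun t => (h (r t))%:E).
  by move=> mh; apply/measurable_EFinP; exact: (measurableT_comp mh).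
have mL (h : R -> R) : measurable_fun setT h -> (forall t, 0 <= h (r t)) ->
    measurable_fun [set: R] (fun x =>
      lebint_tuple (fun t => (h (r [tuple of x :: t]))%:E)).
  move=> mh h0.
  apply: (measurable_lebint_tuple (measurable_lebint_cons (mK _ mh))) => z.
  by rewrite lee_fin.
have h1 t : 0 <= r t ^+ k.+1 / r t * g (r t).
  by rewrite !mulr_ge0 ?exprn_ge0 ?invr_ge0.
have h2 t : 0 <= r t ^+ k * g (r t) by rewrite mulr_ge0// exprn_ge0.
(* The point e = 0 lies in the hyperplane where the first coordinate is 0, so discarding that single
   value of the outermost variable is enough. *)
apply: (@ge0_eq_integral_off_point _ _ _ 0).
- apply: (mL (fun u => u ^+ k.+1 / u * g u)) => //.
  apply: measurable_funM => //; apply: measurable_funM; first exact: exprn_measurable.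
  exact: measurable_invr.
- apply: (mL (fun u => u ^+ k * g u)) => //.
  by apply: measurable_funM => //; exact: exprn_measurable.
- by move=> x; apply: lebint_tuple_ge0 => t; rewrite lee_fin ?h1 ?h2.
- by move=> x; apply: lebint_tuple_ge0 => t; exact: (h2 [tuple of x :: t]).
move=> x x0; apply: eq_lebint_tuple => t; rewrite exprSr mulfK//.
rewrite /r sqn_tcol_cons gt_eqF// ltr_pwDl ?sqn_ge0//.
by rewrite exprn_even_gt0.
Qed.

End radial.

(** * Total mass and second moment of the Gaussian density *)

Section gauss.
Context {R : realType}.
Local Notation leb := (@lebesgue_measure R).

Definition egauss (x : R) : R := expR (- (x ^+ 2 / 2)).

Lemma continuous_egauss : continuous egauss.
Proof.
move=> x; apply: (@continuous_comp _ _ _ (fun x : R => - (x ^+ 2 / 2)) expR).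
  apply: cvgN; apply: cvgM; last exact: cvg_cst.
  exact: exprn_continuous.
exact: continuous_expR.
Qed.

Lemma measurable_egauss : measurable_fun [set: R] egauss.
Proof. by apply: continuous_measurable_fun; exact: continuous_egauss. Qed.

Lemma is_derive_egauss (x : R) :
  is_derive x 1 (fun y => - egauss y) (x * egauss x).
Proof.
have dsq : is_derive x 1 (fun y : R => - (y ^+ 2 / 2)) (- x).
  apply: is_derive_eq.
  by rewrite scaler0 !scaler0 add0r /GRing.scale /= mulr1; field.
have dexp := is_derive1_comp (is_derive_expR _) dsq.
have dN : is_derive x 1 (- (expR \o (fun y : R => - (y ^+ 2 / 2)))) _ := is_deriveN dexp.
by apply: (is_derive_eq dN); rewrite /egauss mulrN opprK mulrC.
Qed.

Lemma cvg_egauss : egauss x @[x --> +oo] --> (0 : R).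
Proof.
apply: (cvg_comp (fun x => x ^+ 2 / 2) (fun x => expR (- x))); last exact: cvgr_expR.
apply: gt0_cvgMly; last exact: cvgr_expr2.
by rewrite invr_gt0.
Qed.

(** The integrand has primitive [- egauss], which tends to 0 at +oo. *)
Lemma integral_x_egauss (a : R) : 0 <= a ->
  (\int[leb]_(x in `[a, +oo[) (x * egauss x)%:E = (egauss a)%:E)%E.
Proof.
move=> a0; have cF := @continuous_egauss.
rewrite (@ge0_continuous_FTC2y _ _ (fun x => - egauss x) _ 0)//.
- by rewrite EFinN oppeK add0e.
- by move=> x ax; rewrite mulr_ge0 ?expR_ge0// (le_trans a0).
- apply: continuous_subspaceT => x; apply: cvgM; [exact: cvg_id|exact: cF].
- by rewrite -oppr0; apply: cvgN; exact: cvg_egauss.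
- by apply: cvgN; apply/cvg_at_right_filter; exact: cF.
- move=> x _; have dF := is_derive_egauss x; rewrite derive1E; exact: derive_val.
Qed.

(** Integration by parts done by Tonelli. By symmetry only x >= 0 matters; there x^2 [egauss x] is
    the integral of x [egauss x] over u in [0, x], and integrating over x >= u first returns
    [egauss u]. *)
Lemma integral_sqr_egauss :
  (\int[leb]_x (x ^+ 2 * egauss x)%:E = \int[leb]_x (egauss x)%:E)%E.
Proof.
have cF := @continuous_egauss.
rewrite (@ge0_symfun_integralT _ (fun x => x ^+ 2 * egauss x)); last 3 first.
- by move=> x; rewrite mulr_ge0 ?sqr_ge0 ?expR_ge0.
- by move=> x; apply: cvgM; [exact: exprn_continuous|exact: cF].
- by move=> x /=; rewrite /egauss sqrrN.
rewrite (@ge0_symfun_integralT _ egauss); last 3 first.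
- by move=> x; rewrite expR_ge0.
- exact: cF.
- by move=> x /=; rewrite /egauss sqrrN.
congr (_ * _)%E.
have mem_ge0 (x : R) : (x \in [set y : R | 0 <= y]) = (0 <= x).
  by apply/idP/idP => [/set_mem|/mem_set].
(* The joint integrand in (x, u), supported on the wedge 0 <= u <= x. *)
pose K (z : R * R) : \bar R :=
  if (0 <= z.2) && (z.2 <= z.1) then (z.1 * egauss z.1)%:E else 0%E.
transitivity (\int[leb]_x \int[leb]_u K (x, u))%E.
  rewrite integral_mkcond; apply: eq_integral => x _.
  rewrite patchE mem_ge0; have [x0|x0] := leP 0 x.
    rewrite [RHS](_ : _ = \int[leb]_(u in `[0%R, x]) (x * egauss x)%:E)%E.
      rewrite integral_cst//= lebesgue_measure_itv /= lte_fin.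
      move: x0; rewrite le_eqVlt => /predU1P[<-|->].
        by rewrite expr0n /= !mul0r mul0e.
      by rewrite sube0 -EFinM expr2 mulrAC.
    rewrite [RHS]integral_mkcond; apply: eq_integral => u _.
    by rewrite patchE mem_setE in_itv.
  rewrite integral0_eq// => u _; rewrite /K /=; case: ifP => // /andP[u0 ux].
  by move: x0; rewrite ltNge (le_trans u0 ux).
rewrite (@fubini_tonelli _ _ _ _ _ leb leb K); last 2 first.
- apply: measurable_fun_ifT => //.
    by apply: measurable_and; apply: measurable_fun_ler => //; exact: measurable_snd.
  apply/measurable_EFinP; apply: measurable_funM => //.
  exact: (measurableT_comp measurable_egauss).
- move=> z; rewrite /K; case: ifP => // /andP[z0 z1].
  by rewrite lee_fin mulr_ge0 ?expR_ge0// (le_trans z0).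
rewrite [RHS]integral_mkcond; apply: eq_integral => u _.
rewrite patchE mem_ge0; have [u0|u0] := leP 0 u.
  rewrite -integral_x_egauss// [RHS]integral_mkcond; apply: eq_integral => x _.
  by rewrite /K /= u0 patchE mem_setE in_itv /= andbT.
by rewrite integral0_eq// => x _; rewrite /K /=; rewrite leNgt u0.
Qed.

(** The standard normal density, in the form in which it factors out of [gauss_gen]. *)
Definition phi (x : R) : R := (Num.sqrt (2 * pi))^-1 * egauss x.

Lemma phi_ge0 x : 0 <= phi x.
Proof. by rewrite mulr_ge0 ?expR_ge0// invr_ge0. Qed.

Lemma measurable_phi : measurable_fun [set: R] phi.
Proof. by apply: measurable_funM => //; exact: measurable_egauss. Qed.

Lemma integral_phi : (\int[leb]_x (phi x)%:E = 1)%E.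
Proof.
rewrite -(integral_normal_pdf (0 : R) 1); apply: eq_integral => x _.
rewrite normal_pdfE ?oner_eq0// /normal_peak /normal_fun /phi /egauss subr0 expr1n.
by rewrite mul1r mulr_natl mulNr.
Qed.

Lemma integral_sqr_phi : (\int[leb]_x (x ^+ 2 * phi x)%:E = 1)%E.
Proof.
rewrite -integral_phi /phi.
under eq_integral do rewrite mulrCA EFinM.
under [RHS]eq_integral do rewrite EFinM.
rewrite !ge0_integralZl// ?lee_fin ?invr_ge0 ?sqrtr_ge0//.
- by rewrite integral_sqr_egauss.
- by apply/measurable_EFinP; exact: measurable_egauss.
- by move=> x _; rewrite lee_fin expR_ge0.
- apply/measurable_EFinP; apply: measurable_funM; last exact: measurable_egauss.
  exact: exprn_measurable.
- by move=> x _; rewrite lee_fin mulr_ge0 ?sqr_ge0 ?expR_ge0.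
Qed.

Lemma gauss_gen_ge0 (n : nat) (q : R) : 0 <= gauss_gen n q.
Proof. by rewrite mulr_ge0 ?expR_ge0// invr_ge0 exprn_ge0// sqrtr_ge0. Qed.

Lemma measurable_gauss_gen (n : nat) : measurable_fun [set: R] (@gauss_gen R n).
Proof.
apply: measurable_funM => //.
apply: (measurableT_comp (@measurable_expR R)).
apply: (measurableT_comp (@oppr_measurable R setT)).
exact: mulrr_measurable.
Qed.

(** Independence of the coordinates: splitting off one of them drives the inductions on the
    dimension. *)
Lemma gauss_genS (n : nat) (x q : R) :
  gauss_gen n.+1 (x ^+ 2 + q) = phi x * gauss_gen n q.
Proof.
rewrite /gauss_gen /phi /egauss [(_ + q) / 2]mulrDl opprD expRD exprS invfM.
by rewrite -!mulrA; congr (_ * _); rewrite mulrCA.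
Qed.

Lemma gauss_gen0 (q : R) : gauss_gen 0 q = expR (- (q / 2)).
Proof. by rewrite /gauss_gen expr0 invr1 mul1r. Qed.

Lemma measurable_radial (n : nat) (h : R -> R) :
  measurable_fun setT h ->
  measurable_fun [set: n.-tuple R] (fun t => (h (sqn (tcol t)))%:E).
Proof.
by move=> mh; apply/measurable_EFinP;
  exact: (measurableT_comp mh (@measurable_sqn_tcol R n)).
Qed.

Lemma sqn_tcol0 (t : 0.-tuple R) : sqn (tcol t) = 0.
Proof. by rewrite sqnE big_ord0. Qed.

Lemma gauss_gen_mass (n : nat) :
  lebint_tuple (fun t : n.-tuple R => (gauss_gen n (sqn (tcol t)))%:E) = 1%E.
Proof.
elim: n => [|n IH] /=.
  by rewrite sqn_tcol0 gauss_gen0 mul0r oppr0 expR0.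
rewrite -integral_phi; apply: eq_integral => x _.
transitivity (lebint_tuple (fun t : n.-tuple R =>
    (phi x)%:E * (gauss_gen n (sqn (tcol t)))%:E))%E.
  by apply: eq_lebint_tuple => t; rewrite sqn_tcol_cons gauss_genS EFinM.
rewrite lebint_tupleZl ?IH ?mule1//.
- by apply: measurable_radial; exact: measurable_gauss_gen.
- by move=> t; rewrite lee_fin gauss_gen_ge0.
- by rewrite lee_fin phi_ge0.
Qed.

(** Split |e|^2 as x^2 plus the squared norm of the other coordinates: the first term contributes
    the variance 1, the second the induction value [n]. *)
Lemma gauss_gen_moment (n : nat) :
  lebint_tuple (fun t : n.-tuple R =>
    (sqn (tcol t) * gauss_gen n (sqn (tcol t)))%:E) = n%:R%:E.
Proof.
have mg n' := @measurable_radial n' _ (measurable_gauss_gen n').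
have mqg n' : measurable_fun [set: n'.-tuple R] (fun t =>
    (sqn (tcol t) * gauss_gen n' (sqn (tcol t)))%:E).
  apply: (@measurable_radial _ (fun q => q * gauss_gen n' q)).
  by apply: measurable_funM => //; exact: measurable_gauss_gen.
have g0 n' (t : n'.-tuple R) : (0 <= (gauss_gen n' (sqn (tcol t)))%:E)%E.
  by rewrite lee_fin gauss_gen_ge0.
have qg0 n' (t : n'.-tuple R) :
    (0 <= (sqn (tcol t) * gauss_gen n' (sqn (tcol t)))%:E)%E.
  by rewrite lee_fin mulr_ge0 ?gauss_gen_ge0 ?sqn_ge0.
elim: n => [|n IH] /=; first by rewrite sqn_tcol0 mul0r.
transitivity (\int[leb]_x ((x ^+ 2 * phi x)%:E + n%:R%:E * (phi x)%:E))%E.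
  apply: eq_integral => x _.
  transitivity (lebint_tuple (fun t : n.-tuple R =>
      (x ^+ 2 * phi x)%:E * (gauss_gen n (sqn (tcol t)))%:E +
      (phi x)%:E * (sqn (tcol t) * gauss_gen n (sqn (tcol t)))%:E))%E.
    apply: eq_lebint_tuple => t; rewrite sqn_tcol_cons gauss_genS.
    by rewrite -!EFinM -EFinD; congr EFin; ring.
  have p0 : (0 <= (phi x)%:E)%E by rewrite lee_fin phi_ge0.
  have q0 : (0 <= (x ^+ 2 * phi x)%:E)%E.
    by rewrite lee_fin mulr_ge0 ?phi_ge0 ?sqr_ge0.
  rewrite lebint_tupleD; last 4 first.
  - apply: measurable_funeM; exact: mg.
  - apply: measurable_funeM; exact: mqg.
  - by move=> t; rewrite mule_ge0.
  - by move=> t; rewrite mule_ge0.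
  by rewrite !lebint_tupleZl// gauss_gen_mass IH mule1 [in RHS]muleC.
have mphi : measurable_fun [set: R] (fun x => (phi x)%:E).
  by apply/measurable_EFinP; exact: measurable_phi.
rewrite ge0_integralD//; last 4 first.
- by move=> x _; rewrite lee_fin mulr_ge0 ?phi_ge0 ?sqr_ge0.
- apply/measurable_EFinP; apply: measurable_funM; last exact: measurable_phi.
  exact: exprn_measurable.
- by move=> x _; rewrite mule_ge0// lee_fin phi_ge0.
- exact: measurable_funeM.
rewrite ge0_integralZl//; last by move=> x _; rewrite lee_fin phi_ge0.
by rewrite integral_sqr_phi integral_phi mule1 -EFinD -natr1 addrC.
Qed.

End gauss.

(** * Moment conditions on the density and independence of c_k from it *)

Section posterior.
Context {R : realType}.
Local Notation leb := (@lebesgue_measure R).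

(** The two integrals are the right-hand sides of [radial_identity] for k = 0 and k = 1; the second
    is the trace of the identity covariance. *)
Definition moments_normalized (n : nat) (g : R -> R) : Prop :=
  [/\ measurable_fun setT g, (forall r, 0 <= g r),
    lebint_tuple (fun t : n.-tuple R => (g (sqn (tcol t)))%:E) = 1%E &
    lebint_tuple (fun t : n.-tuple R => (sqn (tcol t) * g (sqn (tcol t)))%:E)
      = n%:R%:E].

Lemma moments_normalized_gauss (n : nat) : moments_normalized n (@gauss_gen R n).
Proof.
split; [exact: measurable_gauss_gen|exact: gauss_gen_ge0|
  exact: gauss_gen_mass|exact: gauss_gen_moment].
Qed.

(** [f] is controlled only on [0, +oo[, so its argument is clipped at 0, which changes nothing at
    squared norms. The second moment is the sum of the diagonal covariances. *)
Lemma moments_normalized_spherical (n : nat) (f : R -> R) :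
  spherical_density n f -> moments_normalized n (fun t => f (Num.max 0 t)).
Proof.
move=> [mf f0 mass _ cov].
have maxE (t : n.-tuple R) : Num.max 0 (sqn (tcol t)) = sqn (tcol t).
  by apply/max_idPr; exact: sqn_ge0.
have mf' : measurable_fun [set: R] (fun t => f (Num.max 0 t)).
  apply: (measurable_comp _ _ mf); first exact: measurable_itv.
    by move=> _ [t _ <-]; rewrite /= in_itv /= andbT le_max lexx.
  exact: measurable_maxr.
have f0' t : 0 <= f (Num.max 0 t) by rewrite f0// le_max lexx.
split => //.
  rewrite -mass; apply: eq_lebint_tuple => t; by rewrite maxE.
transitivity (lebint_tuple (fun t : n.-tuple R =>
    \sum_(i < n) (tnth t i ^+ 2 * f (Num.max 0 (sqn (tcol t))))%:E)%E).
  apply: eq_lebint_tuple => t; rewrite sumEFin -mulr_suml; congr (_ * _)%:E.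
  by rewrite sqnE; apply: eq_bigr => i _; rewrite mxE.
rewrite lebint_tuple_sum; last 2 first.
- move=> i; apply/measurable_EFinP; apply: measurable_funM.
    by apply: measurable_funX; exact: measurable_tnth.
  exact: (measurableT_comp mf' (@measurable_sqn_tcol R n)).
- by move=> i t; rewrite lee_fin mulr_ge0 ?sqr_ge0.
transitivity (\sum_(i < n) (1 : \bar R))%E; last first.
  by rewrite sumEFin sumr_const card_ord.
apply: eq_bigr => i _; have [_] := cov i i; rewrite eqxx => <-.
by apply: eq_lebint_tuple => t; rewrite maxE !mxE expr2.
Qed.

(** Multiplied by the same A, both constants give the same moment; what remains is to justify
    cancelling A in the extended reals. *)
Lemma scale_int_normalized (n k : nat) (g h : R -> R) :
  (0 < n)%N -> (k <= 1)%N -> moments_normalized n g -> moments_normalized n h ->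
  scale_int n k g 1 = scale_int n k h 1.
Proof.
move=> n0 k1 [mg g0 mass_g cov_g] [mh h0 mass_h cov_h].
pose A := lebint_tuple (fun t : n.-tuple R =>
  (radial_weight n (sqn (tcol t)))%:E).
have gA : (scale_int n k g 1 * A = scale_int n k h 1 * A)%E.
  rewrite /A !radial_identity//; case: k k1 => [|[|//]] _.
    under eq_lebint_tuple do rewrite expr0 mul1r.
    under [RHS]eq_lebint_tuple do rewrite expr0 mul1r.
    by rewrite mass_g mass_h.
  under eq_lebint_tuple do rewrite expr1.
  under [RHS]eq_lebint_tuple do rewrite expr1.
  by rewrite cov_g cov_h.
(* The mass identity c_0 A = 1 excludes both A = 0 and A = +oo, so A never has to be computed. *)
have gA1 : (scale_int n 0 g 1 * A = 1)%E.
  rewrite /A radial_identity// -mass_g.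
  by apply: eq_lebint_tuple => t; rewrite expr0 mul1r.
have A0 : (0 <= A)%E.
  apply: lebint_tuple_ge0 => t; rewrite lee_fin /radial_weight.
  by rewrite !mulr_ge0 ?indic12_ge0 ?invr_ge0 ?exprn_ge0 ?sqrtr_ge0 ?sqn_ge0.
have c0 := scale_int_ge0 n 0 1 g0.
move: A A0 gA gA1 => [a| |] //.
  move=> _ gA gA1.
  have a0 : a != 0.
    by apply/eqP => a0; move: gA1; rewrite a0 mule0 => -[] /eqP; rewrite eq_sym oner_eq0.
  have mulaK (c : \bar R) : c = (c * a%:E * (a^-1)%:E)%E.
    by rewrite -muleA -EFinM divff// mule1.
  by rewrite (mulaK (scale_int n k g 1)) gA -mulaK.
(* If A were +oo, c_0 A would be 0 or +oo according to whether c_0 vanishes, never 1. *)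
move=> _ _; move: c0; rewrite le_eqVlt => /predU1P[<-|c0].
  by rewrite mul0e => -[] /eqP; rewrite eq_sym oner_eq0.
by rewrite gt0_muley.
Qed.

(** * Posterior integrals over the intercept, the coefficients and the variance *)

Section posterior_integral.
Variables (n p : nat) (prior : R -> 'cV[R]_p -> R).
Variables (X : 'M[R]_(n, p)) (y : 'cV[R]_n).
Hypothesis prior_ge0 : forall a b, 0 <= prior a b.

Let Q (a : R) (b : 'cV[R]_p) : R := sqn (y - a *: ones R n - X *m b).

Let inner (k : nat) (g : R -> R) (a : R) (b : 'cV[R]_p) : \bar R :=
  (\int[leb]_(s in (`]0%R, +oo[%classic : set R))
    ((s ^- k) * ((Num.sqrt s) ^- n * g (Q a b / s)) * (prior a b * s^-1))%:E)%E.

Lemma inner_scale_int (k : nat) (g : R -> R) (a : R) (b : 'cV[R]_p) :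
  measurable_fun setT g -> (forall r, 0 <= g r) ->
  inner k g a b = ((prior a b)%:E * scale_int n k g (Q a b))%E.
Proof.
move=> mg g0; rewrite /inner /scale_int !integral_positive -ge0_integralZl//.
- by apply: eq_integral => s _; rewrite -EFinM; congr EFin; ring.
- exact: measurable_positive_scale_integrand.
- by move=> s _; exact: positive_scale_integrand_ge0.
- by rewrite lee_fin prior_ge0.
Qed.

Lemma measurable_residual :
  measurable_fun [set: R * p.-tuple R] (fun z => Q z.1 (tcol z.2)).
Proof.
rewrite (_ : (fun z => _) = fun z : R * p.-tuple R =>
    \sum_i (y i 0 - z.1 - \sum_j X i j * tnth z.2 j) ^+ 2); last first.
  apply/funext => z; rewrite /Q sqnE; apply: eq_bigr => i _.
  rewrite !mxE mulr1; congr ((_ - _) ^+ 2).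
  by apply: eq_bigr => j _; rewrite mxE.
apply: measurable_sum => i; apply: measurable_funX.
apply: measurable_funB; first exact: measurable_funB.
apply: measurable_sum => j; apply: measurable_funM => //.
exact: (measurableT_comp (@measurable_tnth _ R p j)).
Qed.

(** Supplies the measurability in the intercept that [ge0_eq_integral_off_point] asks for, starting
    from joint measurability in (a, b, s). *)
Lemma measurable_inner (k : nat) (g : R -> R) :
  measurable_fun setT g -> (forall r, 0 <= g r) ->
  measurable_fun [set: R * p.-tuple R] (fun z => prior z.1 (tcol z.2)) ->
  measurable_fun [set: R]
    (fun a => lebint_tuple (fun t => inner k g a (tcol t))).
Proof.
move=> mg g0 mprior.
pose K (z : (R * p.-tuple R) * R) : \bar R :=
  ((prior z.1.1 (tcol z.1.2)) * (positive_indic z.2 * (z.2 ^- k *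
   (Num.sqrt z.2 ^- n * g (Q z.1.1 (tcol z.1.2) / z.2)) * z.2^-1)))%:E.
have mK : measurable_fun [set: (R * p.-tuple R) * R] K.
  apply/measurable_EFinP; apply: measurable_funM.
    exact: (measurableT_comp mprior).
  apply: measurable_funM.
    exact: (measurableT_comp measurable_positive_indic).
  apply: measurable_scale_integrand => //.
  exact: (measurableT_comp measurable_residual).
have K0 z : (0 <= K z)%E.
  rewrite /K EFinM; apply: mule_ge0; first by rewrite lee_fin prior_ge0.
  exact: positive_scale_integrand_ge0.
have innerE z : inner k g z.1 (tcol z.2) = (\int[leb]_s K (z, s))%E.
  rewrite /inner integral_positive; apply: eq_integral => s _.
  by rewrite /K /=; congr EFin; ring.
apply: (@measurable_lebint_tuple _ _ _ _ (fun z => inner k g z.1 (tcol z.2))).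
  under eq_fun do rewrite innerE.
  exact: (@measurable_fun_fubini_tonelli_F _ _ _ _ _ leb K).
by move=> z; rewrite innerE; exact: integral_ge0.
Qed.

(* Orthogonality of the columns of X to 1_n forces the intercept of an exact
   fit to be the mean of y. *)
Lemma residual_gt0 (a : R) (b : 'cV[R]_p) :
  (0 < n)%N -> X^T *m ones R n = 0 ->
  a != ((ones R n)^T *m y) 0 0 / n%:R -> 0 < Q a b.
Proof.
move=> n0 X1 ay; rewrite lt_neqAle sqn_ge0 andbT eq_sym.
apply: contra ay => /eqP /sqn_eq0 /eqP.
rewrite subr_eq0 => /eqP yE.
have : (ones R n)^T *m (y - a *: ones R n) = 0.
  rewrite yE mulmxA (_ : _ *m X = 0) ?mul0mx//.
  by apply: trmx_inj; rewrite trmx_mul trmxK X1 trmx0.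
rewrite mulmxBr -scalemxAr => /eqP; rewrite subr_eq0 => /eqP ->.
rewrite !mxE (_ : \sum_j _ = n%:R) ?mulfK ?pnatr_eq0 -?lt0n//.
rewrite (eq_bigr (fun=> 1)); first by rewrite sumr_const card_ord.
by move=> i _; rewrite !mxE mulr1.
Qed.

(** Where the residual is positive, [scale_intE] reduces the inner integrals to c_k, which is common
    to [g] and [h]. A zero residual can occur only for one value of the intercept, a null set. *)
Lemma post_int_normalized (k : nat) (g h : R -> R) :
  (0 < n)%N -> X^T *m ones R n = 0 -> (k <= 1)%N ->
  measurable_fun [set: R * p.-tuple R] (fun z => prior z.1 (tcol z.2)) ->
  moments_normalized n g -> moments_normalized n h ->
  post_int g prior X y k = post_int h prior X y k.
Proof.
move=> n0 X1 k1 mprior Mg Mh; have ce := scale_int_normalized n0 k1 Mg Mh.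
case: Mg Mh => [mg g0 _ _] [mh h0 _ _].
have inner_ge0 (u : R -> R) a b : measurable_fun setT u ->
    (forall r, 0 <= u r) -> (0 <= inner k u a b)%E.
  by move=> mu u0; rewrite inner_scale_int// mule_ge0 ?lee_fin ?scale_int_ge0.
apply: (@ge0_eq_integral_off_point _ _ _ (((ones R n)^T *m y) 0 0 / n%:R)).
- exact: measurable_inner.
- exact: measurable_inner.
- by move=> a; apply: lebint_tuple_ge0 => t; exact: inner_ge0.
- by move=> a; apply: lebint_tuple_ge0 => t; exact: inner_ge0.
move=> a ay; apply: eq_lebint_tuple => t.
rewrite -/(inner k g a (tcol t)) -/(inner k h a (tcol t)) !inner_scale_int//.
have q0 := residual_gt0 (tcol t) n0 X1 ay.
by rewrite (scale_intE _ _ mg)// (scale_intE _ _ mh)// ce.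
Qed.

(** For s > 0 the density is evaluated only at quotients of a squared norm by s, which are
    nonnegative. *)
Lemma post_int_max0 (k : nat) (f : R -> R) :
  post_int f prior X y k = post_int (fun t => f (Num.max 0 t)) prior X y k.
Proof.
apply: eq_integral => a _; apply: eq_lebint_tuple => t.
apply: eq_integral => s; rewrite inE /= in_itv /= andbT => s0.
by rewrite (max_idPr _)// divr_ge0 ?sqn_ge0// ltW.
Qed.

End posterior_integral.
End posterior.

Unset Implicit Arguments.

Theorem theorem2p1 (R : realType) (n p : nat) (X : 'M[R]_(n, p))
    (f : R -> R) (prior : R -> 'cV[R]_p -> R) (y : 'cV[R]_n) :
  (p.+1 < n)%N ->
  X^T *m ones R n = 0 ->
  \rank X = p ->
  spherical_density n f ->
  (forall a b, 0 <= prior a b) ->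
  measurable_fun [set: R * p.-tuple R] (fun z => prior z.1 (tcol z.2)) ->
  (0 < post_int f prior X y 0)%E ->
  (post_int f prior X y 0 < +oo)%E ->
  (post_int f prior X y 1 < +oo)%E ->
  gb_stein f prior X y = gb_stein (gauss_gen (R:=R) n) prior X y.
Proof.
move=> pn X1 _ fS prior0 mprior _ _ _.
have n0 : (0 < n)%N by apply: leq_trans pn.
have Mf := moments_normalized_spherical fS.
have Mg := @moments_normalized_gauss R n.
(* The numerator (k = 1) and the denominator (k = 0) of the posterior mean agree separately with
   their Gaussian counterparts. *)
rewrite /gb_stein !(post_int_max0 _ _ _ _ f).
by rewrite !(post_int_normalized y prior0 n0 X1 _ mprior Mf Mg).
Qed.
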